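(* Every connected graph admits a $\{1,2,4\}$-Hamiltonian cycle. Furthermore, such a cycle can be found in linear time.
   Context: All graphs are finite, simple, undirected, without self-loops and non-empty. A walk of length $k$ in $G$ is a sequence of vertices $(u_0,\dots,u_k)$ with consecutive vertices adjacent; vertices may repeat. For $S \subseteq \mathbb{N}^+$, an $S$-Hamiltonian cycle of $G$ is a sequence $(v_1,\dots,v_n)$ listing every vertex of $G$ exactly once such that for each $i<n$, and also for the pair $(v_n,v_1)$, the two vertices are joined by a walk in $G$ whose length lies in $S$.
   Formalization: The one-vertex graph has no walk of positive length, so under the literal definition it has no {1,2,4}-Hamiltonian cycle; the formal statement requires the pair (v_n, v_1) to be joined by a walk only when n > 1. *)

(* Defs.v *)
From mathcomp Require Import all_boot.
Set Implicit Arguments.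
Unset Strict Implicit.
Unset Printing Implicit Defensive.

Definition is_graph (T : finType) (e : rel T) : Prop :=
  [/\ 0 < #|T|, symmetric e & irreflexive e].

Definition connected_graph (T : finType) (e : rel T) : Prop :=
  forall x y, connect e x y.

Definition edge_set (T : finType) (e : rel T) : {set {set T}} :=
  [set [set x; y] | x in [set: T], y in [set: T] & e x y].

(* [x :: p] is a walk of length [size p]; vertices may repeat. *)
Definition walk_joined (T : finType) (e : rel T) (S : {pred nat}) (x y : T) :
    Prop :=
  exists p : seq T, [/\ path e x p, last x p = y & size p \in S].

(* When [s] has a single entry there is no closing pair to join: the           *)
(* one-vertex graph has no walk of positive length, and its only vertex counts *)
(* as a (trivial) cycle.  [x0] is just a default value for [nth].              *)
Definition S_hamiltonian_cycle (T : finType) (e : rel T) (S : {pred nat})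
    (s : seq T) : Prop :=
  [/\ uniq s,
      forall x, x \in s,
      forall x0 i, i.+1 < size s ->
        walk_joined e S (nth x0 s i) (nth x0 s i.+1)
    & forall x0, 1 < size s ->
        walk_joined e S (nth x0 s (size s).-1) (nth x0 s 0)].

(* Time is measured on a word RAM, whose programs are given in structured form *)
(* over registers R_0, R_1, ... and a memory M_0, M_1, ... of natural numbers. *)
Inductive ram : Type :=
| Const (x k : nat)             (* R_x := k         *)
| Add (x y z : nat)             (* R_x := R_y + R_z *)
| Sub (x y z : nat)             (* R_x := R_y - R_z *)
| Fetch (x y : nat)             (* R_x := M_(R_y)   *)
| Store (x y : nat)             (* M_(R_x) := R_y   *)
| Seq (p q : ram)
| If (x : nat) (p q : ram)      (* if R_x > 0 then p else q *)
| While (x : nat) (p : ram).    (* while R_x > 0 do p *)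

Record state : Type := State { regs : nat -> nat; memory : nat -> nat }.

Definition set_reg (s : state) (x v : nat) : state :=
  State [eta regs s with x |-> v] (memory s).

Definition set_mem (s : state) (a v : nat) : state :=
  State (regs s) [eta memory s with a |-> v].

(* [exec W p s t s']: from [s], [p] halts in [s'] after exactly [t] unit-cost  *)
(* steps (elementary instructions and tests).  Words range over 0, ..., W;     *)
(* computing a larger number is an error, with no transition.  The bound is    *)
(* checked only where a value can exceed those already present.                *)
Inductive exec (W : nat) : ram -> state -> nat -> state -> Prop :=
| exec_Const x k s :
    k <= W -> exec W (Const x k) s 1 (set_reg s x k)
| exec_Add x y z s :
    regs s y + regs s z <= W ->
    exec W (Add x y z) s 1 (set_reg s x (regs s y + regs s z))
| exec_Sub x y z s :
    exec W (Sub x y z) s 1 (set_reg s x (regs s y - regs s z))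
| exec_Fetch x y s :
    exec W (Fetch x y) s 1 (set_reg s x (memory s (regs s y)))
| exec_Store x y s :
    exec W (Store x y) s 1 (set_mem s (regs s x) (regs s y))
| exec_Seq p q s1 t1 s2 t2 s3 :
    exec W p s1 t1 s2 -> exec W q s2 t2 s3 ->
    exec W (Seq p q) s1 (t1 + t2) s3
| exec_If_pos x p q s t s' :
    0 < regs s x -> exec W p s t s' -> exec W (If x p q) s t.+1 s'
| exec_If_zero x p q s t s' :
    regs s x = 0 -> exec W q s t s' -> exec W (If x p q) s t.+1 s'
| exec_While_stop x p s :
    regs s x = 0 -> exec W (While x p) s 1 s
| exec_While_step x p s1 t1 s2 t2 s3 :
    0 < regs s1 x -> exec W p s1 t1 s2 -> exec W (While x p) s2 t2 s3 ->
    exec W (While x p) s1 (t1 + t2).+1 s3.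

Definition initial_state (input : seq nat) : state :=
  State (fun=> 0) (nth 0 input).

(* The neighbours of each vertex are listed in an arbitrary order. *)
Definition adjacency_lists (n : nat) (e : rel 'I_n)
    (adj : 'I_n -> seq 'I_n) : Prop :=
  forall v, uniq (adj v) /\ forall w, (w \in adj v) = e v w.

(* Cell 0 holds n; the list of v occupies the cells from M_(v+1) (included) to *)
(* M_(v+2) (excluded); the lists start at cell n+2, after the n+1 pointers.    *)
Definition encode_graph (n : nat) (adj : 'I_n -> seq 'I_n) : seq nat :=
  let lists := [seq [seq val w | w <- adj v] | v <- enum 'I_n] in
  n :: [seq n.+2 + sumn (take v (shape lists)) | v <- iota 0 n.+1]
    ++ flatten lists.

(* "A cycle can be found in linear time": one program, on every connected      *)
(* graph with n vertices and m edges, uses O(n + m) steps on words bounded by  *)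
(* O(n + m), i.e. of log(n + m) + O(1) bits, and leaves the successive         *)
(* vertices of a cycle in cells 0, ..., n-1.                                   *)
Definition linear_time_S_hamiltonian_cycle (S : {pred nat}) : Prop :=
  exists (p : ram) (b c : nat),
  forall (n : nat) (e : rel 'I_n) (adj : 'I_n -> seq 'I_n),
    is_graph e -> connected_graph e -> adjacency_lists e adj ->
    exists (t : nat) (s : state) (cyc : seq 'I_n),
      [/\ exec (b * (n + #|edge_set e|)) p
            (initial_state (encode_graph adj)) t s,
          t <= c * (n + #|edge_set e|),
          [seq memory s i | i <- iota 0 n] = [seq val v | v <- cyc]
        & S_hamiltonian_cycle e S cyc].

(* Main.v *)
(* Root a spanning tree at r.  By induction each rooted tree has a Hamiltonian *)
(* path with steps of tree distance 1, 2 or 4, from the root to one of its     *)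
(* children: to a path v ... c, with c a child of v, add the subtree of a new  *)
(* child w of v as follows.  If w is a leaf, append it after c (distance 2).   *)
(* Otherwise its path w ... d, with d a child of w, is inserted just after v:  *)
(* as v d ... w when the old successor of v is a child of v (distances 2 and   *)
(* 2), and as v w ... d when it is a grandchild (distances 1 and 4).  Each     *)
(* insertion exchanges the two cases.                                          *)
(*                                                                             *)
(* For linear time, breadth-first search numbers the vertices so that parents  *)
(* come before children, and children are added in decreasing order.  Since    *)
(* paths get reversed, a path is stored without orientation: each vertex keeps *)
(* the sum of its two neighbours, to which every insertion contributes by      *)
(* additions only, and walking the final path recovers the next vertex by      *)
(* subtracting the previous one.                                               *)

Require Import Defs.
From mathcomp Require Import all_boot zify.
Set Implicit Arguments.
Unset Strict Implicit.
Unset Printing Implicit Defensive.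

(** * Paths and sums of neighbours *)

(** The invariant is asymmetric: the path at [v] always ends in a child of [v], while its first step
    may reach a child or a grandchild, as recorded by [F]. The end condition closes the cycle at the
    root by an edge and puts the end within distance 2 of the parent of [v]. The flag decides the
    orientation in which the path of a new child is inserted; the other orientation would create a
    step of distance 3. The three insertions are [forest_leaf], [forest_flip] and [forest_keep];
    [near] lists the steps they create and [near_walk] realizes these by walks of length 1, 2 or 4.

    An insertion touches only the ends of two paths, so it takes constant time, and the search costs
    a sum of degrees. Loop-free code is verified by [runs_wp], loops by the budgets of [runs_while].
    The phases are [bfs_runs], [absorb_loop_runs] and [output_loop_runs], composed in [search_runs].
    Existence of a cycle is then read off the output of the program. *)

Lemma size_segment n (s : seq nat) : uniq s ->
  (forall x, (x \in s) = (x < n)) -> size s = n.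
Proof.
move=> us s_n; rewrite -(size_iota 0 n); apply: perm_size.
by apply: uniq_perm; rewrite ?iota_uniq // => x; rewrite s_n mem_iota.
Qed.

Definition link (a b x : nat) : nat := (x == a) * b + (x == b) * a.

(* [link_sum a s x] adds up the neighbours of [x] along the path [a :: s].      *)
Fixpoint link_sum (a : nat) (s : seq nat) (x : nat) : nat :=
  if s is b :: s' then link a b x + link_sum b s' x else 0.

Lemma linkC a b x : link a b x = link b a x.
Proof. by rewrite /link addnC. Qed.

Lemma link_sum_cat a s1 b s2 x :
  link_sum a (s1 ++ b :: s2) x =
  link_sum a s1 x + link (last a s1) b x + link_sum b s2 x.
Proof. by elim: s1 a => [|c s1 IH] a //=; rewrite IH !addnA. Qed.

(** This invariance lets [forest_flip] reverse a path of any length for free. *)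
Lemma link_sum_rev a s x :
  link_sum (last a s) (rev (belast a s)) x = link_sum a s x.
Proof.
elim: s a => [|b s IH] a //=; rewrite rev_cons -cats1 link_sum_cat IH /= addn0.
rewrite addnC (linkC _ a); congr (link _ _ _ + _).
case: s {IH} => [|c s] //=.
by rewrite rev_cons last_rcons.
Qed.

Lemma link_sum_notin a s x : x \notin a :: s -> link_sum a s x = 0.
Proof.
elim: s a => [|b s IH] a //=; rewrite !inE !negb_or => /and3P[xa xb xs].
by rewrite IH ?inE ?negb_or ?xb // /link (negbTE xa) (negbTE xb).
Qed.

(** Entries being distinct, an entry meets only its own two links, so subtracting its predecessor
    yields its successor. A neighbour missing at either end counts as 0. *)
Lemma link_sum_nth a s k : uniq (a :: s) -> k < size (a :: s) ->
  link_sum a s (nth 0 (a :: s) k) =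
  (if k is j.+1 then nth 0 (a :: s) j else 0) + nth 0 s k.
Proof.
elim: s a k => [|b s IH] a [|k] //= /and3P[].
- rewrite inE negb_or => /andP[ab a_s] bs us.
  by rewrite link_sum_notin ?inE ?negb_or ?ab // /link eqxx (negbTE ab) !addn0 mul1n.
- rewrite inE negb_or => /andP[ab a_s] bs us; rewrite !ltnS => ks.
  rewrite IH /= ?bs //.
  case: k ks => [|k] ks /=; rewrite /link.
    by rewrite eqxx mul1n eq_sym (negbTE ab) !add0n.
  have s_k: nth 0 s k \in s by rewrite mem_nth.
  rewrite (negbTE (memPn a_s _ s_k)) (negbTE (memPn bs _ s_k)); lia.
Qed.

(** An occurrence of [x] takes part in at most two links. The term [(x == a) * m] reserves room for
    a link entering the head, which the induction needs. *)
Lemma link_sum_bound m a s x : all (leq^~ m) (a :: s) ->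
  link_sum a s x + (x == a) * m <= 2 * m * count_mem x (a :: s).
Proof.
elim: s a => [|b s IH] a /= /andP[am].
  by move=> _; rewrite eq_sym; case: (a == x) => //=; lia.
move=> /[dup] abs /IH /=; move: abs => /= /andP[bm _].
rewrite /link (eq_sym x) (eq_sym x); case: (a == x); case: (b == x) => /=; lia.
Qed.

(** * Adding subtrees *)

(** Applied to [X v], this omits the link from [v] to its successor. That link is recorded only when
    the path at [v] is final, so an insertion right after [v] never has to remove a link. *)
Definition links (s : seq nat) (x : nat) : nat :=
  if s is a :: s' then link_sum a s' x else 0.

Section Forest.

Variables (n : nat) (par : nat -> nat).
Hypothesis par_lt : forall i, 0 < i < n -> par i < i.

Definition child (v w : nat) : bool := (0 < w < n) && (par w == v).

Definition grandchild (v w : nat) : bool :=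
  [&& 0 < w < n, 0 < par w & par (par w) == v].

(** The last two cases are siblings and vertices with a common grandparent; there [child (par x) x]
    only says that [0 < x < n], and similarly for [grandchild]. Symmetry matters because paths get
    reversed. *)
Definition near (x y : nat) : bool :=
  [|| child x y, child y x, grandchild x y, grandchild y x,
      child (par x) x && child (par x) y
    | grandchild (par (par x)) x && grandchild (par (par x)) y].

Lemma child_child u v w : child u v -> child v w -> grandchild u w.
Proof.
case/andP=> /andP[v0 _] /eqP uv /andP[w_n /eqP vw].
by rewrite /grandchild w_n vw v0 uv eqxx.
Qed.

Lemma near_sym : symmetric near.
Proof.
have sib z t :
    child (par z) z && child (par z) t = child (par t) t && child (par t) z.
  by rewrite /child !eqxx !andbT eq_sym andbCA.
have cousin z t :
    grandchild (par (par z)) z && grandchild (par (par z)) t =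
    grandchild (par (par t)) t && grandchild (par (par t)) z.
  rewrite /grandchild !eqxx !andbT (eq_sym (par (par t))).
  by case: (0 < z < n); case: (0 < t < n); case: (0 < par z); case: (0 < par t).
move=> x y; rewrite /near (sib x) (cousin x) orbCA.
by congr [|| _, _ | _]; exact: orbCA.
Qed.

(* [X v] is the path that starts at [v], without [v] itself, after the children *)
(* of [v] numbered at least [j] have been added.  [H] and [E] give its ends (0  *)
(* when it is empty: the root is nobody's child), [S] the sums of neighbours,   *)
(* and [F v] tells that the successor of [v] is a grandchild.                   *)
Record forest (j : nat) (S H E F : nat -> nat) (X : nat -> seq nat) : Prop :=
  Forest {
    forest_path : forall v, v < j -> path near v (X v);
    forest_first : forall v, v < j -> H v = head 0 (X v);
    forest_last : forall v, v < j -> E v = last 0 (X v);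
    forest_last_child :
      forall v, v < j -> X v != [::] -> child v (last 0 (X v));
    forest_first_child :
      forall v, v < j -> F v = 0 -> X v != [::] -> child v (head 0 (X v));
    forest_first_grandchild :
      forall v, v < j -> 0 < F v -> X v != [::] /\ grandchild v (head 0 (X v));
    forest_count :
      forall x, \sum_(v < j) count_mem x ((v : nat) :: X v) = (x < n);
    forest_links : forall x, x < n -> S x = \sum_(v < j) links (X v) x
  }.

Lemma sum_replace (g g' : nat -> nat) i p : p < i ->
  (forall v, v != p -> g' v = g v) ->
  \sum_(v < i) g' v + g p = \sum_(v < i) g v + g' p.
Proof.
move=> p_i gE; rewrite [in LHS](bigD1 (Ordinal p_i)) //.
rewrite [in RHS](bigD1 (Ordinal p_i)) //=.
under eq_bigr => v vp do rewrite gE //.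
by rewrite addnAC [RHS]addnAC (addnC (g p)).
Qed.

(** A nonempty path starts with a child or a grandchild, hence with a positive number; so the
    program can test emptiness by comparing [H v] with 0. *)
Lemma forest_first0 j S H E F X v : forest j S H E F X -> v < j ->
  (H v == 0) = (X v == [::]).
Proof.
move=> fX vj; rewrite (forest_first fX) //.
case Xv: (X v) => [|h t]; first by [].
have Xv0: X v != [::] by rewrite Xv.
case: (posnP (F v)) => [F0|F1].
  by have := forest_first_child fX vj F0 Xv0; rewrite Xv /child /=; case: h {Xv}.
have [_] := forest_first_grandchild fX vj F1.
by rewrite Xv /grandchild /=; case: h {Xv}.
Qed.

(** Common part of the three insertions: [i] leaves the index range and only the path at its parent
    changes, to [Y]. *)
Lemma forest_absorb i S H E F X S' H' E' F' Y :
  let p := par i in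
  0 < i < n -> forest i.+1 S H E F X ->
  path near p Y -> Y != [::] -> child p (last 0 Y) ->
  (F' p = 0 -> child p (head 0 Y)) ->
  (0 < F' p -> grandchild p (head 0 Y)) ->
  (forall x, count_mem x Y = count_mem x (i :: X i) + count_mem x (X p)) ->
  (forall x, x < n ->
     S' x + links (X i) x + links (X p) x = S x + links Y x) ->
  (forall v, v < i -> H' v = if v == p then head 0 Y else H v) ->
  (forall v, v < i -> E' v = if v == p then last 0 Y else E v) ->
  (forall v, v < i -> v != p -> F' v = F v) ->
  forest i S' H' E' F' (fun v => if v == p then Y else X v).
Proof.
move=> p i_n fX Yp Y0 Yl F0 F1 Yc SE HE EE FE.
have p_i: p < i by apply: par_lt.
have lt v : v < i -> v < i.+1 by lia.
split=> [v vi|v vi|v vi|v vi|v vi|v vi|x|x xn].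
- by case: eqP => [-> //|_]; apply: (forest_path fX); apply: lt.
- by rewrite HE //; case: eqP => // _; apply: (forest_first fX); apply: lt.
- by rewrite EE //; case: eqP => // _; apply: (forest_last fX); apply: lt.
- by case: (v =P p) => [-> //|_]; apply: (forest_last_child fX); apply: lt.
- case: (v =P p) => [-> /F0 //|/eqP vp]; rewrite FE //.
  by apply: (forest_first_child fX); apply: lt.
- case: (v =P p) => [-> /F1 //|/eqP vp]; rewrite FE //.
  by apply: (forest_first_grandchild fX); apply: lt.
- have /(sum_replace p_i) : forall v, v != p ->
      count_mem x (v :: if v == p then Y else X v) = count_mem x (v :: X v).
    by move=> v /negbTE ->.
  rewrite eqxx -(forest_count fX x) big_ord_recr /= Yc /=; lia.
- have /(sum_replace p_i) : forall v, v != p ->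
      links (if v == p then Y else X v) x = links (X v) x.
    by move=> v /negbTE ->.
  have := SE x xn; rewrite eqxx (forest_links fX) // big_ord_recr /=; lia.
Qed.

(** The leaf goes to the far end, next to a sibling, or next to [p] if the path was empty. Either
    way [F] stays correct. *)
Lemma forest_leaf i S H E F X S' H' E' F' :
  let p := par i in
  0 < i < n -> forest i.+1 S H E F X -> H i = 0 ->
  (forall x, x < n -> S' x = S x + (if 0 < H p then link (E p) i x else 0)) ->
  (forall v, H' v = if (v == p) && (H p == 0) then i else H v) ->
  (forall v, E' v = if v == p then i else E v) ->
  (forall v, F' v = F v) ->
  exists X', forest i S' H' E' F' X'.
Proof.
move=> p i_n fX Hi SE HE EE FE.
have p_i: p < i by apply: par_lt.
have pi : p < i.+1 by lia.
have Xi : X i = [::] by apply/eqP; rewrite -(forest_first0 fX) // Hi.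
have ip : child p i by rewrite /child i_n eqxx.
have Hp0 := forest_first0 fX pi.
have hl := forest_last_child fX pi.
have pX := forest_path fX pi.
have h0 := forest_first_child fX pi.
have h1 := forest_first_grandchild fX pi.
have eE := forest_last fX pi.
have eH := forest_first fX pi.
eexists; apply: (forest_absorb (Y := rcons (X p) i) i_n fX) => //.
- rewrite rcons_path pX /= /near.
  case Xp: (X p) hl => [|h t] /=; first by rewrite ip.
  by move=> /(_ isT); move: ip; rewrite /child; lia.
- by case: (X p).
- by rewrite last_rcons.
- by rewrite FE; case: (X p) h0 => [|h t] //= h0 /h0 ->.
- by rewrite FE => /h1 []; case: (X p).
- by move=> x; rewrite -cats1 count_cat Xi addnC.
- move=> x xn; rewrite SE // lt0n Hp0 eE Xi /=.
  case: (X p) => [|h t] /=; first by rewrite !addn0.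
  by rewrite -cats1 link_sum_cat /=; lia.
- move=> v vi; rewrite HE Hp0; case: eqP => [->|_] //=.
  by rewrite eH; case: (X p).
- by move=> v vi; rewrite EE last_rcons.
Qed.

(** Reversal puts the end of [X i], a grandchild of [p], next to [p], and [i] next to its sibling.
    If [X p] is empty, [i] becomes the end, which is again a child of [p]. *)
Lemma forest_flip i S H E F X S' H' E' F' :
  let p := par i in
  0 < i < n -> forest i.+1 S H E F X -> 0 < H i -> F p = 0 ->
  (forall x, x < n ->
     S' x = S x + link i (H i) x + (if 0 < H p then link i (H p) x else 0)) ->
  (forall v, H' v = if v == p then E i else H v) ->
  (forall v, E' v = if (v == p) && (H p == 0) then i else E v) ->
  (forall v, F' v = if v == p then 1 else F v) ->
  exists X', forest i S' H' E' F' X'.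
Proof.
move=> p i_n fX Hi Fp SE HE EE FE.
have p_i: p < i by apply: par_lt.
have pi : p < i.+1 by lia.
have Xi : X i != [::] by rewrite -(forest_first0 fX) // -lt0n.
have ip : child p i by rewrite /child i_n eqxx.
have Hp0 := forest_first0 fX pi.
have hl := forest_last_child fX pi.
have pX := forest_path fX pi.
have h0 := forest_first_child fX pi Fp.
have eE := forest_last fX pi.
have eH := forest_first fX pi.
have il := forest_last_child fX (ltnSn i) Xi.
have iE := forest_last fX (ltnSn i).
have iH := forest_first fX (ltnSn i).
have iX := forest_path fX (ltnSn i).
have lXi a : last a (X i) = last 0 (X i) by case: (X i) Xi.
have gl : grandchild p (last 0 (X i)).
  exact: child_child ip il.
have revE : rev (i :: X i) = last 0 (X i) :: rev (belast i (X i)).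
  by rewrite lastI rev_rcons lXi.
have lastr a : last a (rev (i :: X i)) = i by rewrite rev_cons last_rcons.
eexists; apply: (forest_absorb (Y := rev (i :: X i) ++ X p) i_n fX) => //.
- rewrite cat_path lastr; apply/andP; split.
    rewrite revE /= {1}/near gl !orbT /= -(lXi i) rev_path.
    by under eq_path => x y do rewrite near_sym.
  case Xp: (X p) h0 pX => [|h t] //= /(_ isT) h0 /andP[_ ->].
  by rewrite /near; move: ip h0; rewrite /child; lia.
- by rewrite revE.
- rewrite last_cat lastr; case Xp: (X p) hl => [|h t] //= -> //.
- by rewrite FE eqxx.
- by rewrite revE.
- by move=> x; rewrite count_cat count_rev.
- move=> x xn; rewrite SE // lt0n Hp0 iH eH revE /=.
  have := link_sum_rev i (X i) x; rewrite lXi => er.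
  case: (X p) => [|h t] /=.
    rewrite cats0 er; case: (X i) Xi => [|c s] //= _; lia.
  have lr : last (last 0 (X i)) (rev (belast i (X i))) = i.
    by have := lastr 0; rewrite revE.
  rewrite link_sum_cat er lr; case: (X i) Xi => [|c s] //= _; lia.
- by move=> v vi; rewrite HE iE revE.
- move=> v vi; rewrite EE Hp0 last_cat lastr; case: eqP => [->|] //=.
  by rewrite eE; case: (X p).
- by move=> v vi vp; rewrite FE (negbTE vp).
Qed.

(** The junction joins two grandchildren of [p], the end of [X i] and the old successor. A positive
    [F p] makes [X p] nonempty, so the end does not move. *)
Lemma forest_keep i S H E F X S' H' E' F' :
  let p := par i in
  0 < i < n -> forest i.+1 S H E F X -> 0 < H i -> 0 < F p ->
  (forall x, x < n -> S' x = S x + link i (H i) x + link (E i) (H p) x) ->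
  (forall v, H' v = if v == p then i else H v) ->
  (forall v, E' v = E v) ->
  (forall v, F' v = if v == p then 0 else F v) ->
  exists X', forest i S' H' E' F' X'.
Proof.
move=> p i_n fX Hi Fp SE HE EE FE.
have p_i: p < i by apply: par_lt.
have pi : p < i.+1 by lia.
have Xi : X i != [::] by rewrite -(forest_first0 fX) // -lt0n.
have ip : child p i by rewrite /child i_n eqxx.
have hl := forest_last_child fX pi.
have pX := forest_path fX pi.
have [Xp h1] := forest_first_grandchild fX pi Fp.
have eE := forest_last fX pi.
have eH := forest_first fX pi.
have il := forest_last_child fX (ltnSn i) Xi.
have iE := forest_last fX (ltnSn i).
have iH := forest_first fX (ltnSn i).
have iX := forest_path fX (ltnSn i).
have lXi a : last a (X i) = last 0 (X i) by case: (X i) Xi.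
have gl : grandchild p (last 0 (X i)).
  exact: child_child ip il.
have lXp : last 0 ((i :: X i) ++ X p) = last 0 (X p).
  by rewrite last_cat; case: (X p) Xp.
eexists; apply: (forest_absorb (Y := (i :: X i) ++ X p) i_n fX) => //.
- rewrite cat_path /= iX {1}/near ip lXi /=.
  case: (X p) Xp h1 pX => [|h t] //= _ h1 /andP[_ ->].
  by rewrite /near; move: gl h1; rewrite /grandchild; lia.
- by rewrite lXp; apply: hl.
- by rewrite FE eqxx.
- by move=> x; rewrite count_cat.
- move=> x xn; rewrite SE // iE iH eH /=.
  case: (X p) Xp => [|h t] //= _; rewrite link_sum_cat lXi.
  case: (X i) Xi => [|c s] //= _; lia.
- by move=> v vi; rewrite EE lXp; case: eqP => [->|].
- by move=> v vi vp; rewrite FE (negbTE vp).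
Qed.

Lemma forest_init S H E F : (forall x, S x = 0) -> (forall v, H v = 0) ->
  (forall v, E v = 0) -> (forall v, F v = 0) ->
  forest n S H E F (fun=> [::]).
Proof.
move=> S0 H0 E0 F0; split=> [//|v _|v _|//|//|v _|x|x _]; rewrite ?S0 ?H0 ?E0 ?F0 //.
  2: by rewrite big1.
case: (ltnP x n) => xn /=; last first.
  rewrite big1 // => v _; case: eqP => // vx.
  by move: (ltn_ord v); rewrite vx ltnNge xn.
rewrite (bigD1 (Ordinal xn)) //= big1 ?eqxx // => v.
by rewrite -val_eqE /= => /negbTE ->.
Qed.

Lemma forest_mem j S H E F X v y :
  forest j S H E F X -> v < j -> y \in v :: X v -> y < n.
Proof.
move=> fX vj; rewrite -has_pred1 has_count => y_v; rewrite -[y < n]lt0b.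
by rewrite -(forest_count fX y) (bigD1 (Ordinal vj)) //= addn_gt0 y_v.
Qed.

Lemma forest_first_lt j S H E F X v :
  forest j S H E F X -> v < j -> H v < n.
Proof.
move=> fX vj; have := @forest_mem _ _ _ _ _ _ v (H v) fX vj.
have := @forest_mem _ _ _ _ _ _ v v fX vj; rewrite mem_head (forest_first fX) //.
case: (X v) => [|h t] /=; first by move=> /(_ isT) + _; apply: leq_ltn_trans.
by rewrite !inE eqxx orbT => _; apply.
Qed.

Lemma forest_last_lt j S H E F X v :
  forest j S H E F X -> v < j -> E v < n.
Proof.
move=> fX vj; have := @forest_mem _ _ _ _ _ _ v (E v) fX vj.
have := @forest_mem _ _ _ _ _ _ v v fX vj; rewrite mem_head (forest_last fX) //.
case: (X v) => [|h t]; first by move=> /(_ isT) + _; apply: leq_ltn_trans.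
by rewrite /= in_cons mem_last orbT => _; apply.
Qed.

(** Each [x < n] occurs exactly once over all paths, so the bounds of [link_sum_bound] add up to a
    single [2 * n]. This keeps the sums within a word. *)
Lemma forest_bound j S H E F X x :
  forest j S H E F X -> x < n -> S x <= 2 * n.
Proof.
move=> fX xn; rewrite (forest_links fX) //.
apply: (@leq_trans (2 * n * (\sum_(v < j) count_mem x ((v : nat) :: X v)))); last first.
  by rewrite (forest_count fX) xn muln1.
rewrite big_distrr leq_sum //= => v _.
case Xv: (X v) => [|h t] //.
have /(link_sum_bound x) : all (leq^~ n) (h :: t).
  apply/allP => y; rewrite -Xv => yX.
  by apply: ltnW (forest_mem fX (ltn_ord v) _); rewrite inE yX orbT.
by rewrite /=; lia.
Qed.

Lemma forest_cycle S H E F X : forest 1 S H E F X ->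
  let s := X 0 in
  [/\ uniq (0 :: s), forall x, (x \in 0 :: s) = (x < n),
      path near 0 s, s != [::] -> near (last 0 s) 0
    & H 0 = head 0 s /\ forall x, x < n -> S x = links s x].
Proof.
move=> fX s; have sC x : count_mem x (0 :: s) = (x < n).
  by rewrite -(forest_count fX x) big_ord1.
split.
- apply: count_mem_uniq => x; rewrite sC; congr nat_of_bool.
  by rewrite -has_pred1 has_count sC lt0b.
- by move=> x; rewrite -has_pred1 has_count sC lt0b.
- exact: (forest_path fX).
- by move=> s0; rewrite /near (forest_last_child fX) ?orbT.
- split; first exact: (forest_first fX).
  by move=> x xn; rewrite (forest_links fX) // big_ord1.
Qed.

End Forest.

(** * Programs over registers and arrays *)

Inductive cmd : Type :=
| CConst (x k : nat)
| CAdd (x y z : nat)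
| CSub (x y z : nat)
| CGet (k x y : nat)
| CPut (k y x : nat)
| CSeq (c d : cmd)
| CIf (x : nat) (c d : cmd).

(* Memory is divided into array 0, the first [A] cells, which holds the input    *)
(* and finally the output, followed by arrays 1, ..., 7 of [n] cells each:       *)
(* queue, marks of seen vertices, parents, sums of neighbours, and [H], [E], [F] *)
(* of the record [forest].  The last five are indexed by positions in the queue. *)
(* Registers 0, 1, 2 hold 0, 1, [n], register 20 + k the base of array k, and    *)
(* register 19 is scratch.                                                       *)
Fixpoint compile (c : cmd) : ram :=
  match c with
  | CConst x k => Const x k
  | CAdd x y z => Add x y z
  | CSub x y z => Defs.Sub x y z
  | CGet k x y => Seq (Add x (20 + k) y) (Fetch x x)
  | CPut k y x => Seq (Add 19 (20 + k) y) (Store 19 x)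
  | CSeq c d => Seq (compile c) (compile d)
  | CIf x c d => If x (compile c) (compile d)
  end.

Fixpoint well_formed (c : cmd) : bool :=
  match c with
  | CConst x k => x < 19
  | CAdd x y z | CSub x y z => [&& x < 19, y < 19 & z < 19]
  | CGet k x y | CPut k x y => [&& k < 8, x < 19 & y < 19]
  | CSeq c d => well_formed c && well_formed d
  | CIf x c d => [&& x < 19, well_formed c & well_formed d]
  end.

Fixpoint cost (c : cmd) : nat :=
  match c with
  | CConst _ _ | CAdd _ _ _ | CSub _ _ _ => 1
  | CGet _ _ _ | CPut _ _ _ => 2
  | CSeq c d => cost c + cost d
  | CIf _ c d => (maxn (cost c) (cost d)).+1
  end.

Definition put (a : nat -> nat -> nat) (k i v k' i' : nat) : nat :=
  if (k' == k) && (i' == i) then v else a k' i'.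
Arguments put : simpl never.

Lemma put_add a k i v j :
  put a k i (a k i + v) k j = a k j + (j == i) * v.
Proof. by rewrite /put eqxx /=; case: eqP => [->|_] /=; lia. Qed.

(* [wp] and [runs] see the machine as registers 0, ..., 18 and the 8 arrays.     *)
Section Machine.

Variables W n A : nat.

Definition array_base (k : nat) : nat := if k is k'.+1 then A + k' * n else 0.

Definition array_size (k : nat) : nat := if k is 0 then A else n.

Hypothesis word_size : A + 7 * n <= W.

Definition represents (s : state) (r : nat -> nat) (a : nat -> nat -> nat) :=
  [/\ forall x, x < 19 -> regs s x = r x,
      forall k, k < 8 -> regs s (20 + k) = array_base k
    & forall k i, k < 8 -> i < array_size k ->
        memory s (array_base k + i) = a k i].

Fixpoint wp (c : cmd) (r : nat -> nat) (a : nat -> nat -> nat)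
    (Q : (nat -> nat) -> (nat -> nat -> nat) -> Prop) : Prop :=
  match c with
  | CConst x k => k <= W /\ Q [eta r with x |-> k] a
  | CAdd x y z => r y + r z <= W /\ Q [eta r with x |-> r y + r z] a
  | CSub x y z => Q [eta r with x |-> r y - r z] a
  | CGet k x y => r y < array_size k /\ Q [eta r with x |-> a k (r y)] a
  | CPut k y x => r y < array_size k /\ Q r (put a k (r y) (r x))
  | CSeq c d => wp c r a (fun r' a' => wp d r' a' Q)
  | CIf x c d => (0 < r x -> wp c r a Q) /\ (r x = 0 -> wp d r a Q)
  end.

Definition runs (p : ram) (T : nat) (r : nat -> nat) (a : nat -> nat -> nat)
    (Q : (nat -> nat) -> (nat -> nat -> nat) -> Prop) : Prop :=
  forall s, represents s r a -> exists t s' r' a',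
    [/\ exec W p s t s', t <= T, represents s' r' a' & Q r' a'].

Lemma array_end k i : k < 8 -> i < array_size k -> array_base k + i <= W.
Proof. by case: k => [|k] /=; nia. Qed.

(** The arrays occupy disjoint intervals, so a store changes one abstract cell only. *)
Lemma array_inj k i k' i' : i < array_size k -> i' < array_size k' ->
  (array_base k + i == array_base k' + i') = (k == k') && (i == i').
Proof.
case: k k' => [|k] [|k'] /= ik ik'; try by lia.
rewrite eqSS -!addnA eqn_add2l; apply/idP/idP; last first.
  by case/andP=> /eqP -> /eqP ->.
by case: (ltngtP k k') => kk'; nia.
Qed.

Lemma represents_reg s r a x v : x < 19 -> represents s r a ->
  represents (set_reg s x v) [eta r with x |-> v] a.
Proof.
move=> x19 [rE bE mE]; split=> //= [y y19|k k8].
  by case: eqP => // _; apply: rE.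
by case: eqP => [|_]; [lia | apply: bE].
Qed.

Lemma runs_wp c r a Q : well_formed c -> wp c r a Q ->
  runs (compile c) (cost c) r a Q.
Proof.
elim: c r a Q => [x k|x y z|x y z|k x y|k y x|c IHc d IHd|x c IHc d IHd] r a Q /=.
- move=> x19 [kW q] s rep; exists 1, (set_reg s x k).
  eexists _, _; split; [exact: exec_Const | by [] | | exact: q].
  exact: (represents_reg _ x19 rep).
- case/and3P=> x19 y19 z19 [leW q] s rep; have [rE _ _] := rep.
  exists 1; eexists; eexists _, _.
  split; [|by []| |exact: q].
    by apply: exec_Add; rewrite !rE.
  by rewrite !rE //; exact: (represents_reg _ x19 rep).
- case/and3P=> x19 y19 z19 q s rep; have [rE _ _] := rep.
  exists 1; eexists; eexists _, _.
  split; [exact: exec_Sub|by []| |exact: q].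
  by rewrite !rE //; exact: (represents_reg _ x19 rep).
- case/and3P=> k8 x19 y19 [yk q] s rep; have [rE bE mE] := rep.
  exists 2; eexists; eexists _, _; split; [|by []| |exact: q].
    apply: (@exec_Seq _ _ _ _ 1 _ 1); last exact: exec_Fetch.
    by apply: exec_Add; rewrite bE // rE // array_end.
  rewrite /= eqxx bE // rE // mE //.
  have := represents_reg (a k (r y)) x19 rep.
  case=> rE' bE' mE'; split=> // z z19.
    by rewrite -(rE' z) //=; case: eqP.
  by rewrite -(bE' z) //=; case: eqP.
- case/and3P=> k8 y19 x19 [yk q] s rep; have [rE bE mE] := rep.
  exists 2; eexists; eexists _, _; split; [|by []| |exact: q].
    apply: (@exec_Seq _ _ _ _ 1 _ 1); last exact: exec_Store.
    by apply: exec_Add; rewrite bE // rE // array_end.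
  split=> [z z19|k' k'8|k' i k'8 ik'] /=.
  + by case: eqP => [|_]; [lia | exact: rE].
  + exact: bE.
  + rewrite bE // rE // array_inj // /put; case: ifP => _; last exact: mE.
    by case: eqP => [|_]; [lia | exact: rE].
- case/andP=> wc wd q s /(IHc _ _ _ wc q)[t [s' [r' [a' [e1 t1 rep' q']]]]].
  have [t2 [s2 [r2 [a2 [e2 le2 rep2 q2]]]]] := IHd _ _ _ wd q' s' rep'.
  exists (t + t2), s2, r2, a2; split=> //; last by rewrite leq_add.
  exact: exec_Seq e1 e2.
- case/and3P=> x19 wc wd [q1 q2] s rep; have [rE _ _] := rep.
  case: (posnP (r x)) => rx.
    have [t [s' [r' [a' [e1 t1 rep' q']]]]] := IHd _ _ _ wd (q2 rx) s rep.
    exists t.+1, s', r', a'; split=> //; last by rewrite ltnS leq_max t1 orbT.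
    by apply: exec_If_zero; rewrite ?rE.
  have [t [s' [r' [a' [e1 t1 rep' q']]]]] := IHc _ _ _ wc (q1 rx) s rep.
  exists t.+1, s', r', a'; split=> //; last by rewrite ltnS leq_max t1.
  by apply: exec_If_pos; rewrite ?rE.
Qed.

Lemma runs_weaken p T T' r a (Q Q' : _ -> _ -> Prop) :
  T <= T' -> (forall r' a', Q r' a' -> Q' r' a') ->
  runs p T r a Q -> runs p T' r a Q'.
Proof.
move=> TT' QQ' pQ s /pQ[t [s' [r' [a' [e tT rep q]]]]].
exists t, s', r', a'; split=> //; [exact: leq_trans TT' | exact: QQ'].
Qed.

Lemma runs_seq p q T T' r a Q Q' :
  runs p T r a Q' -> (forall r' a', Q' r' a' -> runs q T' r' a' Q) ->
  runs (Seq p q) (T + T') r a Q.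
Proof.
move=> pQ qQ s /pQ[t [s' [r' [a' [e1 t1 rep' q']]]]].
have [t2 [s2 [r2 [a2 [e2 le2 rep2 q2]]]]] := qQ _ _ q' s' rep'.
exists (t + t2), s2, r2, a2; split=> //; last by rewrite leq_add.
exact: exec_Seq e1 e2.
Qed.

(* The index of the invariant [I] is a budget that pays for the remaining      *)
(* iterations.                                                                 *)
Lemma runs_while x p (I : nat -> (nat -> nat) -> (nat -> nat -> nat) -> Prop)
    k r a :
  x < 19 ->
  (forall k r a, I k r a -> 0 < r x ->
     exists T k', T + k' < k /\ runs p T r a (I k')) ->
  I k r a ->
  runs (While x p) k.+1 r a (fun r' a' => r' x = 0 /\ exists k', I k' r' a').
Proof.
move=> x19 step; elim/ltn_ind: k r a => k IH r a Ik s rep.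
have [rE _ _] := rep; case: (posnP (r x)) => rx.
  exists 1, s, r, a; split=> //; last by split=> //; exists k.
  by apply: exec_While_stop; rewrite rE.
have [T [k' [ltk pT]]] := step _ _ _ Ik rx.
have [t [s' [r' [a' [e1 t1 rep' q']]]]] := pT s rep.
have k'k : k' < k := leq_ltn_trans (leq_addl T k') ltk.
have [t2 [s2 [r2 [a2 [e2 le2 rep2 q2]]]]] := IH k' k'k _ _ q' s' rep'.
exists (t + t2).+1, s2, r2, a2; split=> //; last first.
  by rewrite ltnS (leq_trans (leq_add t1 le2)) // addnS.
by apply: exec_While_step e1 e2; rewrite rE.
Qed.

End Machine.

(** * Breadth-first search *)

Declare Scope cmd_scope.
Delimit Scope cmd_scope with cmd.
Notation "c ;; d" := (CSeq c d) (at level 60, right associativity) : cmd_scope.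
Bind Scope cmd_scope with cmd.

(** Registers of the search: 3 is the queue position being scanned, 4 the queue length, 7 and 8 the
    current and end addresses in the adjacency list, 10 the neighbour and 11 its mark. The
    differences in 5 and 9 guard the two loops. *)
Definition bfs_enter : cmd :=
  (CGet 1 6 3 ;; CAdd 6 6 1 ;; CGet 0 7 6 ;;
   CAdd 6 6 1 ;; CGet 0 8 6 ;; CSub 9 8 7)%cmd.

Definition bfs_visit : cmd :=
  (CGet 0 10 7 ;; CGet 2 11 10 ;;
   CIf 11 (CConst 11 0)
     (CPut 2 10 1 ;; CPut 1 4 10 ;; CPut 3 4 3 ;; CAdd 4 4 1) ;;
   CAdd 7 7 1 ;; CSub 9 8 7)%cmd.

Definition bfs_leave : cmd := (CAdd 3 3 1 ;; CSub 5 4 3)%cmd.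

Definition bfs : ram :=
  While 5 (Seq (compile bfs_enter)
          (Seq (While 9 (compile bfs_visit)) (compile bfs_leave))).

Section Bfs.

Variables (W n A : nat) (nbrs : nat -> seq nat) (start input : nat -> nat).
Hypotheses (n_gt0 : 0 < n) (nA : n.+2 <= A) (word_size : A + 7 * n <= W).
Hypothesis nbrs_lt : forall u v, u < n -> v \in nbrs u -> v < n.
Hypothesis start_end : forall u, u < n -> start u + size (nbrs u) <= A.
Hypothesis input_start : forall u, u < n -> input u.+1 = start u.
Hypothesis input_end : forall u, u < n -> input u.+2 = start u + size (nbrs u).
Hypothesis input_nbrs : forall u j, u < n -> j < size (nbrs u) ->
  input (start u + j) = nth 0 (nbrs u) j.

(** [q] retains the scanned vertices. Parents are stored as positions in [q], which makes them
    smaller than their children. [bfs_blank] provides the zero arrays that [forest_init] asks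
    for. *)
Record bfs_tree (q : seq nat) (a : nat -> nat -> nat) : Prop := BfsTree {
  bfs_uniq : uniq q;
  bfs_lt : forall v, v \in q -> v < n;
  bfs_root : 0 < size q /\ nth 0 q 0 = 0;
  bfs_input : forall i, i < A -> a 0 i = input i;
  bfs_queue : forall i, i < n -> a 1 i = nth 0 q i;
  bfs_seen : forall v, v < n -> a 2 v = (v \in q);
  bfs_parent : forall i, 0 < i < size q ->
    a 3 i < i /\ nth 0 q i \in nbrs (nth 0 q (a 3 i));
  bfs_blank : forall k i, 3 < k -> a k i = 0
}.

Lemma bfs_size q a : bfs_tree q a -> size q <= n.
Proof.
move=> qa; rewrite -(size_iota 0 n); apply: uniq_leq_size (bfs_uniq qa) _ => v vq.
by rewrite mem_iota (bfs_lt qa).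
Qed.

Lemma bfs_push q a h w : bfs_tree q a -> h < size q -> w \in nbrs (nth 0 q h) ->
  w \notin q ->
  size q < n /\
  bfs_tree (rcons q w) (put (put (put a 2 w 1) 1 (size q) w) 3 (size q) h).
Proof.
move=> qa hq wh wq.
have wn : w < n by apply: nbrs_lt wh; apply: (bfs_lt qa); rewrite mem_nth.
have qn : size q < n.
  have /uniq_leq_size : uniq (w :: q) by rewrite /= wq (bfs_uniq qa).
  move=> /(_ (iota 0 n)); rewrite size_iota; apply => v.
  by rewrite inE mem_iota => /predU1P[-> //|/(bfs_lt qa)].
have [q0 r0] := bfs_root qa.
split=> //; split=> [|v|||i iN|v vn|i|k i k3].
- by rewrite rcons_uniq wq (bfs_uniq qa).
- by rewrite mem_rcons inE => /predU1P[-> //|/(bfs_lt qa)].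
- by rewrite size_rcons nth_rcons q0.
- by move=> i iA; rewrite /put /= (bfs_input qa).
- rewrite /put /= nth_rcons (bfs_queue qa) //.
  by case: ltngtP => // qi; rewrite nth_default // ltnW.
- rewrite /put /= mem_rcons inE (bfs_seen qa) //.
  by case: eqP => [->|] //=.
- rewrite size_rcons ltnS => /andP[i0 iq]; rewrite /put /= !nth_rcons.
  case: (ltngtP i (size q)) iq => [iq|//|->] _; last first.
    by rewrite hq.
  have /(bfs_parent qa)[pi qi] : 0 < i < size q by rewrite i0.
  by rewrite (ltn_trans pi iq).
- by case: k k3 => [|[|[|[|k]]]] // _; rewrite /put /= (bfs_blank qa).
Qed.


Definition closed_below (q : seq nat) (h : nat) : Prop :=
  forall i, i < h -> {subset nbrs (nth 0 q i) <= q}.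

(** Time of the search up to the factor 15: one unit per list entry, and one per vertex for entering
    and leaving it. *)
Definition degree_sum (q : seq nat) : nat := \sum_(v <- q) (size (nbrs v)).+1.

Lemma degree_sum_le q : uniq q -> (forall v, v \in q -> v < n) ->
  degree_sum q <= \sum_(v < n) (size (nbrs v)).+1.
Proof.
move=> uq qn; rewrite -(big_mkord xpredT (fun v => (size (nbrs v)).+1)).
rewrite /degree_sum (perm_big [seq v <- iota 0 n | v \in q]) /=.
  by rewrite big_filter /index_iota subn0 big_mkcond leq_sum // => v _; case: ifP.
apply: uniq_perm => //; first by rewrite filter_uniq ?iota_uniq.
move=> v; rewrite mem_filter mem_iota; case vq: (v \in q) => //=.
by rewrite (qn v vq).
Qed.

Definition bfs_registers (h : nat) (q : seq nat) (r : nat -> nat) : Prop :=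
  [/\ r 0 = 0, r 1 = 1, r 2 = n, r 3 = h & r 4 = size q].

Definition bfs_outer (h k : nat) (r : nat -> nat) (a : nat -> nat -> nat) :
    Prop :=
  exists q, [/\ bfs_tree q a, bfs_registers h q r, r 5 = size q - h &
    h <= size q /\ closed_below q h] /\
    k + 15 * degree_sum (take h q) = 15 * \sum_(v < n) (size (nbrs v)).+1.

(* The queue only grows at its end, so the part that has been scanned is fixed *)
(* by the prefix [p].                                                          *)
Definition bfs_inner (p : seq nat) (h u k : nat) (r : nat -> nat)
    (a : nat -> nat -> nat) : Prop :=
  exists q j, [/\ bfs_tree q a, bfs_registers h q r,
    [/\ r 7 = start u + j, r 8 = start u + size (nbrs u),
        r 9 = size (nbrs u) - j & j <= size (nbrs u)],
    [/\ take h.+1 q = p, nth 0 q h = u, h < size q & closed_below q h] &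
    {subset take j (nbrs u) <= q}] /\
    k = 15 * (size (nbrs u) - j).

Lemma bfs_visit_runs p h u k r a : bfs_inner p h u k r a -> 0 < r 9 ->
  exists T k', T + k' < k /\
    runs W n A (compile bfs_visit) T r a (bfs_inner p h u k').
Proof.
move=> [q [j [[qa [r0 r1 r2 r3 r4] [r7 r8 r9 ju] [qp uE hq qh] jq] ->]]] r9_gt0.
have ltj : j < size (nbrs u) by lia.
(* 14 is the cost of [bfs_visit]; the fifteenth unit pays for the loop test. *)
exists 14, (15 * (size (nbrs u) - j.+1)); split; first by lia.
apply: (@runs_wp _ _ _ word_size bfs_visit) => //.
have un : u < n by apply: (bfs_lt qa); rewrite -uE mem_nth.
have := start_end un => su.
have jA : start u + j < A by lia.
have wn : nth 0 (nbrs u) j < n by apply: (nbrs_lt un); rewrite mem_nth.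
have w_u : nth 0 (nbrs u) j \in nbrs (nth 0 q h) by rewrite uE mem_nth.
have sq := bfs_size qa.
rewrite /= !(r1, r3, r4, r7, r8) (bfs_input qa) // input_nbrs // (bfs_seen qa) //.
have takeS q' : {subset q <= q'} -> nth 0 (nbrs u) j \in q' ->
    {subset take j.+1 (nbrs u) <= q'}.
  move=> qq' wq' v; rewrite (take_nth 0) // mem_rcons inE.
  by case/predU1P=> [-> //|/jq/qq'].
do 2 split=> //; split.
  rewrite lt0b => wq; do 2 (split; first by lia).
  exists q, j.+1; split=> //; split=> //=; first by split=> //=; lia.
  exact: takeS.
move=> /eqP; rewrite eqb0 => wq.
have [qn qa'] := bfs_push qa hq w_u wq.
do 5 (split; first by lia).
exists (rcons q (nth 0 (nbrs u) j)), j.+1; split=> //; split=> //=.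
- by split=> //=; rewrite size_rcons addn1.
- by split=> //=; lia.
- split=> //.
  + by rewrite -cats1 takel_cat.
  + by rewrite nth_rcons hq.
  + by rewrite size_rcons ltnW.
  + move=> i ih v; rewrite nth_rcons (ltn_trans ih hq) => /(qh i ih) vq.
    by rewrite mem_rcons inE vq orbT.
- apply: takeS; last by rewrite mem_rcons mem_head.
  by move=> v vq; rewrite mem_rcons inE vq orbT.
Qed.

Lemma bfs_runs r a : bfs_tree [:: 0] a -> bfs_registers 0 [:: 0] r -> r 5 = 1 ->
  runs W n A bfs (15 * \sum_(v < n) (size (nbrs v)).+1).+1 r a
    (fun r' a' => exists q, [/\ bfs_tree q a', r' 0 = 0, r' 1 = 1, r' 2 = n &
       closed_below q (size q)]).
Proof.
move=> qa rE r5.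
set K := 15 * _.
have step k r1 a1 : (exists h, bfs_outer h k r1 a1) -> 0 < r1 5 ->
  exists T k', T + k' < k /\ runs W n A (Seq (compile bfs_enter)
          (Seq (While 9 (compile bfs_visit)) (compile bfs_leave))) T r1 a1
     (fun r' a' => exists h, bfs_outer h k' r' a').
  move=> [h [q [[qa1 [r10 r11 r12 r13 r14] r15 [hq qh]] kE]]] r5_gt0.
  have {}hq : h < size q by lia.
  set u := nth 0 q h.
  have un : u < n by apply: (bfs_lt qa1); rewrite mem_nth.
  have sq := bfs_size qa1.
  have kS : 15 * degree_sum (take h.+1 q) <= K.
    rewrite leq_mul2l degree_sum_le //.
      by rewrite take_uniq // (bfs_uniq qa1).
    by move=> v /mem_take /(bfs_lt qa1).
  have dS : degree_sum (take h.+1 q) = degree_sum (take h q) + (size (nbrs u)).+1.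
    by rewrite (take_nth 0) // /degree_sum -cats1 big_cat big_seq1.
  (* 9 and 2 are the costs of [bfs_enter] and [bfs_leave], and the successor is the last test of the
     inner loop. With the outer test this stays within [15 * (size (nbrs u)).+1]. *)
  exists (9 + ((15 * size (nbrs u)).+1 + 2)), (K - 15 * degree_sum (take h.+1 q)).
  split; first by rewrite -/K in kE; lia.
  apply: (runs_seq (Q' := bfs_inner (take h.+1 q) h u (15 * size (nbrs u)))).
    apply: (@runs_wp _ _ _ word_size bfs_enter) => //=.
    rewrite !(r11, r13) (bfs_queue qa1) -/u; last by lia.
    rewrite !addn1 !(bfs_input qa1) ?(input_start un, input_end un); try by lia.
    do 5 (split; first by lia).
    exists q, 0; split; last by rewrite subn0.
    have u0 : {subset take 0 (nbrs u) <= q} by move=> v; rewrite take0.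
    by split=> //; split=> //=; lia.
  move=> r2 a2 in2.
  apply: runs_seq.
    by apply: runs_while in2 => // k' r3 a3; apply: bfs_visit_runs.
  move=> r3 a3 [r39 [k' [q3 [j [[]]]]]].
  move=> qa3 [r30 r31 r32 r33 r34] [r37 r38 r39' ju] [qp uE hq3 qh3] jq _.
  apply: (@runs_wp _ _ _ word_size bfs_leave) => //=.
  have sq3 := bfs_size qa3.
  rewrite r33 r31 r34; split; first by lia.
  exists h.+1, q3; split; last by rewrite qp -/K; lia.
  split=> //=; first by split=> //=; lia.
    by rewrite addn1.
  split=> // i; rewrite ltnS leq_eqVlt => /predU1P[->|/qh3 //].
  rewrite uE => v vu; apply: jq.
  by rewrite take_oversize //; lia.
have start_outer : exists h, bfs_outer h K r a.
  exists 0, [:: 0]; split; last by rewrite /degree_sum take0 big_nil muln0 addn0.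
  by split=> //; split.
apply: runs_weaken (leqnn _) _
  (runs_while (I := fun k r a => exists h, bfs_outer h k r a) _
     step start_outer) => //.
move=> r' a' [r'5 [k [h [q [[qa' [r'0 r'1 r'2 _ _] r'5' [hq qh]] _]]]]].
exists q; split=> //.
by have <- : h = size q by lia.
Qed.

End Bfs.

(** * Building and writing the cycle *)

Definition add_link (x y : nat) : cmd :=
  (CGet 4 9 x ;; CAdd 9 9 y ;; CPut 4 x 9 ;;
   CGet 4 9 y ;; CAdd 9 9 x ;; CPut 4 y 9)%cmd.

(** Register 3 holds [i] and 5 its parent [p]; 4, 6 and 7 hold [H i], [F p] and [H p]; 8 holds
    [E i], or [E p] when [i] is a leaf. The branches are those of [forest_keep], [forest_flip] and
    [forest_leaf]. *)
Definition absorb : cmd :=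
  (CGet 5 4 3 ;; CGet 3 5 3 ;; CGet 7 6 5 ;; CGet 5 7 5 ;;
   CIf 4
     (add_link 3 4 ;; CGet 6 8 3 ;;
      CIf 6
        (add_link 8 7 ;; CPut 5 5 3 ;; CPut 7 5 0)
        (CIf 7 (add_link 3 7) (CPut 6 5 3) ;; CPut 5 5 8 ;; CPut 7 5 1))
     (CIf 7 (CGet 6 8 5 ;; add_link 8 3) (CPut 5 5 3) ;; CPut 6 5 3) ;;
   CSub 3 3 1)%cmd.

Lemma put_other a k i v k' j : k' != k -> put a k i v k' j = a k' j.
Proof. by move=> /negbTE kk; rewrite /put kk. Qed.

Section Absorb.

Variables (W n A : nat) (par : nat -> nat).
Hypothesis word_size : A + 7 * n <= W.
Hypothesis par_lt : forall i, 0 < i < n -> par i < i.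

(** The bound [4 * n] leaves room for a second link within one [absorb]: the sums start below
    [2 * n] and a link adds at most [2 * n]. *)
Lemma wp_add_link x y r a (Q : _ -> _ -> Prop) :
  x != 9 -> y != 9 -> r x < n -> r y < n -> (forall z, z < n -> a 4 z <= 4 * n) ->
  (forall r' a', (forall z, z != 9 -> r' z = r z) ->
     (forall k z, k != 4 -> a' k z = a k z) ->
     (forall z, a' 4 z = a 4 z + link (r x) (r y) z) -> Q r' a') ->
  wp W n A (add_link x y) r a Q.
Proof.
move=> x9 y9 xn yn a4 q; rewrite /add_link /= (negbTE x9) (negbTE y9).
have := a4 _ xn; have := a4 _ yn => ay ax.
do 4 (split; first by lia).
split; first by rewrite put_add; case: eqP => _; lia.
split; first by [].
apply: q => [z /negbTE z9|k z /negbTE k4|z] /=; first by rewrite z9.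
  by rewrite /put k4.
by rewrite !put_add -addnA.
Qed.

Definition absorb_state (a0 : nat -> nat -> nat) (i : nat) (r : nat -> nat)
    (a : nat -> nat -> nat) : Prop :=
  exists X, [/\ [/\ r 0 = 0, r 1 = 1, r 2 = n & r 3 = i],
    i < n, forall k z, k < 4 -> a k z = a0 k z
  & forest n par i.+1 (a 4) (a 5) (a 6) (a 7) X].

Lemma absorb_next a0 i r a : 0 < i < n ->
  [/\ r 0 = 0, r 1 = 1, r 2 = n & r 3 = i.-1] ->
  (forall k z, k < 4 -> a k z = a0 k z) ->
  (exists X, forest n par i (a 4) (a 5) (a 6) (a 7) X) ->
  absorb_state a0 i.-1 r a.
Proof.
case/andP=> i0 i_n rE aE [X fX]; exists X; split=> //; last by rewrite prednK.
exact: leq_ltn_trans (leq_pred i) i_n.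
Qed.

#[local] Opaque add_link.

Lemma absorb_runs a0 i r a : (forall i, i < n -> a0 3 i = par i) ->
  0 < i -> absorb_state a0 i r a ->
  runs W n A (compile absorb) (cost absorb) r a (absorb_state a0 i.-1).
Proof.
move=> a0par i_gt0 [X [[r0 r1 r2 r3] i_n aE fX]].
apply: (@runs_wp _ _ _ word_size absorb); first exact: isT.
have i0n : 0 < i < n by rewrite i_gt0.
have pi := par_lt i0n.
have pn : par i < n := ltn_trans pi i_n.
have Hi := forest_first_lt fX (ltnSn i).
have Ei := forest_last_lt fX (ltnSn i).
have Hp := forest_first_lt fX (ltnW pi : par i < i.+1).
have Ep := forest_last_lt fX (ltnW pi : par i < i.+1).
have S_le z : z < n -> a 4 z <= 2 * n := forest_bound fX.
have lk x y z : x < n -> y < n -> link x y z <= 2 * n.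
  by move=> xn yn; rewrite /link; case: eqP; case: eqP; lia.
have a3 : a 3 i = par i by rewrite aE // a0par.
have Sn z : z < n -> a 4 z <= 4 * n by move=> /S_le; lia.
have SL x y z : x < n -> y < n -> z < n -> a 4 z + link x y z <= 4 * n.
  by move=> xn yn /S_le; have := lk x y z xn yn; lia.
have low k : k < 4 -> [/\ k != 4, k != 5, k != 6 & k != 7].
  by case: k => [|[|[|[|]]]].
rewrite /= !(r3, a3).
do 4 (split; first by []).
split=> [Hi0|Hi0].
- apply: wp_add_link => //=; first by rewrite r3.
  move=> r' a' r'E a'E a'4.
  have [r'0 r'1 r'2 r'3] : [/\ r' 0 = 0, r' 1 = 1, r' 2 = n & r' 3 = i].
    by rewrite !r'E.
  have [r'5 r'6 r'7] : [/\ r' 5 = par i, r' 6 = a 7 (par i) & r' 7 = a 5 (par i)].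
    by rewrite !r'E.
  have a'6 : a' 6 i = a 6 i by rewrite a'E.
  rewrite !(r'3, r'5, r'6, r'7, a'6).
  split; first by [].
  split=> [Fp|Fp].
    apply: wp_add_link => //=; first by rewrite r'7.
      by move=> z zn; rewrite a'4 /= r3; apply: SL.
    move=> r2' a2' r2'E a2'E a2'4.
    rewrite !r2'E //= !(r'0, r'1, r'3, r'5).
    do 2 (split; first by []).
    apply: absorb_next => //=.
    + by split; rewrite ?r2'E ?subn1.
    + by move=> k z /[dup] /low[? ? ? ?] ?; rewrite !put_other // a2'E // a'E // aE.
    + apply: (forest_keep par_lt i0n fX Hi0 Fp) => v.
      * by move=> vn; rewrite !put_other // a2'4 a'4 /= r3 r'7.
      * by rewrite put_other // /put /= a2'E // a'E.
      * by rewrite !put_other // a2'E // a'E.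
      * by rewrite /put /= a2'E // a'E.
  split=> [Hp0|Hp0].
    apply: wp_add_link => //=; rewrite ?r'3 ?r'7 //.
      by move=> z zn; rewrite a'4 /= r3; apply: SL.
    move=> r2' a2' r2'E a2'E a2'4.
    rewrite !r2'E //= !(r'0, r'1, r'3, r'5).
    do 2 (split; first by []).
    apply: absorb_next => //=.
    + by split; rewrite ?r2'E ?subn1.
    + by move=> k z /[dup] /low[? ? ? ?] ?; rewrite !put_other // a2'E // a'E // aE.
    + apply: (forest_flip par_lt i0n fX Hi0 Fp) => v.
      * by move=> vn; rewrite !put_other // a2'4 a'4 /= r3 Hp0.
      * by rewrite put_other // /put /= a2'E // a'E.
      * by rewrite !put_other // a2'E // a'E // (gtn_eqF Hp0) andbF.
      * by rewrite /put /= a2'E // a'E.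
  do 3 (split; first by []).
  rewrite r'1; apply: absorb_next => //=.
  + by split; rewrite ?subn1.
  + by move=> k z /[dup] /low[? ? ? ?] ?; rewrite !put_other // a'E // aE.
  + apply: (forest_flip par_lt i0n fX Hi0 Fp) => v.
    * by move=> vn; rewrite !put_other // a'4 /= r3 Hp0 addn0.
    * by rewrite put_other // /put /= a'E.
    * by rewrite 2?put_other // /put /= a'E // Hp0 andbT.
    * by rewrite /put /= a'E.
split=> [Hp0|Hp0].
  split; first by [].
  apply: wp_add_link => //=; first by rewrite r3.
  move=> r' a' r'E a'E a'4.
  rewrite !r'E //= !(r1, r3).
  split; first by [].
  apply: absorb_next => //=.
  + by split; rewrite ?r'E ?subn1.
  + by move=> k z /[dup] /low[? ? ? ?] ?; rewrite !put_other // a'E // aE.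
  + apply: (forest_leaf par_lt i0n fX Hi0) => v.
    * by move=> vn; rewrite !put_other // a'4 /= r3 Hp0.
    * by rewrite put_other // a'E // (gtn_eqF Hp0) andbF.
    * by rewrite /put /= a'E.
    * by rewrite put_other // a'E.
do 2 (split; first by []).
apply: absorb_next => //=.
+ by split; rewrite ?r1 ?subn1.
+ by move=> k z /[dup] /low[? ? ? ?] ?; rewrite !put_other // aE.
+ apply: (forest_leaf par_lt i0n fX Hi0) => v.
  * by move=> vn; rewrite !put_other // Hp0 addn0.
  * by rewrite put_other // /put /= Hp0 andbT.
  * by rewrite /put.
  * by rewrite !put_other.
Qed.

End Absorb.

Definition absorb_loop : ram := While 3 (compile absorb).

Definition output_start : cmd :=
  (CGet 5 4 0 ;; add_link 0 4 ;;
   CConst 5 0 ;; CConst 6 0 ;; CConst 7 0 ;; CAdd 8 2 0)%cmd.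

(* Register 6 holds the current vertex and register 7 the previous one.        *)
Definition output_step : cmd :=
  (CGet 1 9 6 ;; CPut 0 5 9 ;; CGet 4 9 6 ;; CSub 9 9 7 ;;
   CAdd 7 6 0 ;; CAdd 6 9 0 ;; CAdd 5 5 1 ;; CSub 8 2 5)%cmd.

Definition output_loop : ram := While 8 (compile output_step).

Section Output.

Variables (W n A : nat) (par : nat -> nat).
Hypotheses (n_gt0 : 0 < n) (nA : n <= A) (word_size : A + 7 * n <= W).
Hypothesis par_lt : forall i, 0 < i < n -> par i < i.

Lemma absorb_loop_runs a0 i r a : (forall i, i < n -> a0 3 i = par i) ->
  absorb_state n par a0 i r a ->
  runs W n A absorb_loop ((cost absorb).+1 * i).+1 r a (absorb_state n par a0 0).
Proof.
move=> a0par st.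
pose I k r a := exists2 i, k = (cost absorb).+1 * i & absorb_state n par a0 i r a.
have step k r1 a1 : I k r1 a1 -> 0 < r1 3 -> exists T k', T + k' < k /\
    runs W n A (compile absorb) T r1 a1 (I k').
  move=> [j -> st1]; have [X [[_ _ _ ->] _ _ _]] := st1 => j0.
  exists (cost absorb), ((cost absorb).+1 * j.-1); split.
    by rewrite -{2}(prednK j0) mulnS ltn_add2r.
  apply: runs_weaken (leqnn _) _ (absorb_runs word_size par_lt a0par j0 st1).
  by move=> r2 a2 st2; exists j.-1.
have st0 : I ((cost absorb).+1 * i) r a by exists i.
apply: runs_weaken (leqnn _) _ (runs_while _ step st0) => //.
move=> r' a' [r'3 [k [j _ st']]].
by have [X [[_ _ _ r'3'] _ _ _]] := st'; move: st'; rewrite -r'3' r'3.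
Qed.

Definition output_state (v : nat -> nat) (s : seq nat) (k : nat)
    (r : nat -> nat) (a : nat -> nat -> nat) : Prop :=
  [/\ [/\ r 0 = 0, r 1 = 1 & r 2 = n],
      [/\ r 5 = k, r 6 = nth 0 (0 :: s) k, r 7 = nth 0 (0 :: s) k.-1,
          r 8 = n - k & k <= n],
      forall i, i < n -> a 1 i = v i,
      forall i, i < n -> a 4 i = link_sum 0 s i
    & forall j, j < k -> a 0 j = v (nth 0 (0 :: s) j)].

#[local] Opaque add_link.

Lemma output_start_runs a0 r a : absorb_state n par a0 0 r a ->
  runs W n A (compile output_start) (cost output_start) r a (fun r' a' =>
    exists s, [/\ output_state (a0 1) s 0 r' a', uniq (0 :: s),
      forall x, (x \in 0 :: s) = (x < n), path (near n par) 0 s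
    & s != [::] -> near n par (last 0 s) 0]).
Proof.
move=> [X [[r0 r1 r2 r3] _ aE fX]].
apply: (@runs_wp _ _ _ word_size output_start); first exact: isT.
have [us smem ps ls [H0 SE]] := forest_cycle fX.
rewrite /= r0; split; first by [].
apply: wp_add_link => //=; first by rewrite r0.
- exact: forest_first_lt fX (ltnSn 0).
- by move=> z /(forest_bound fX); lia.
move=> r' a' r'E a'E a'4; rewrite !r'E //= r0 r2 addn0.
do 4 (split; first by lia).
exists (X 0); split=> //; split=> //=.
- by split; rewrite ?r'E.
- by split; rewrite ?subn0.
- by move=> i i_n; rewrite a'E // aE.
- move=> i i_n; rewrite a'4 SE //= r0 H0.
  (* For a one-vertex graph [H 0] is 0, and linking 0 to itself adds 0. *)
  by case: (X 0) => [|h t] //=; rewrite /link muln0 addn0 ?muln0 // addnC.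
Qed.

Lemma output_step_runs v s k r a : uniq (0 :: s) ->
  (forall x, (x \in 0 :: s) = (x < n)) -> 0 < r 8 ->
  output_state v s k r a ->
  runs W n A (compile output_step) (cost output_step) r a
    (output_state v s k.+1).
Proof.
move=> us smem r8_gt0 [[r0 r1 r2] [r5 r6 r7 r8 k_n] a1 a4 a0k].
have {}k_n : k < n by lia.
have size_s := size_segment us smem.
have nth_n j : nth 0 (0 :: s) j < n.
  case: (ltnP j (size (0 :: s))) => js; last by rewrite nth_default.
  by rewrite -smem mem_nth.
apply: (@runs_wp _ _ _ word_size output_step); first exact: isT.
(* At [k = 0] the predecessor is missing, but [k.-1] then designates the start vertex 0, so that 0
   is subtracted as required. *)
have S_k : link_sum 0 s (nth 0 (0 :: s) k) - nth 0 (0 :: s) k.-1 = nth 0 s k.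
  rewrite link_sum_nth ?size_s //; case: k {r5 r6 r7 r8 a0k k_n} => [|k] /=.
    by rewrite add0n subn0.
  by rewrite addKn.
have snk : nth 0 s k < n := nth_n k.+1.
have := nth_n k => kn.
rewrite /= !(r0, r1, r2, r5, r6, r7) /put /= a1 ?a4 // S_k.
do 6 (split; first by lia).
split=> //=.
- by split; rewrite ?addn0 ?addn1 //; lia.
- by move=> j; rewrite ltnS leq_eqVlt; case: eqP => [->|_] //= /a0k.
Qed.

Lemma output_loop_runs v s r a : uniq (0 :: s) ->
  (forall x, (x \in 0 :: s) = (x < n)) -> output_state v s 0 r a ->
  runs W n A output_loop ((cost output_step).+1 * n).+1 r a
    (fun _ a' => forall j, j < n -> a' 0 j = v (nth 0 (0 :: s) j)).
Proof.
move=> us smem st.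
pose I k r a := exists2 j, k = (cost output_step).+1 * (n - j) & output_state v s j r a.
have step k r1 a1 : I k r1 a1 -> 0 < r1 8 -> exists T k', T + k' < k /\
    runs W n A (compile output_step) T r1 a1 (I k').
  move=> [j -> st1] r8.
  have j_n : j < n by case: st1 => _ [_ _ _ r8' _] _ _ _; lia.
  exists (cost output_step), ((cost output_step).+1 * (n - j.+1)); split.
    by rewrite subnS -{2}(prednK (_ : 0 < n - j)) ?subn_gt0 // mulnS ltn_add2r.
  apply: runs_weaken (leqnn _) _ (output_step_runs us smem r8 st1).
  by move=> r2 a2 st2; exists j.+1.
have st0 : I ((cost output_step).+1 * n) r a by exists 0; rewrite ?subn0.
apply: runs_weaken (leqnn _) _ (runs_while _ step st0) => //.
move=> r' a' [r'8 [k [j _ [_ [_ _ _ r'8' jn] _ _ a0j]]]] i i_n.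
by apply: a0j; lia.
Qed.

End Output.

(** * Correctness of the whole program *)

(** Cell [n + 1] points to the end of the last list, so it holds the length [A] of the input. The
    other arrays are placed beyond, where memory is 0. *)
Definition setup : ram :=
  Seq (Const 1 1) (Seq (Fetch 2 0) (Seq (Add 21 2 1) (Seq (Fetch 21 21)
  (Seq (Add 22 21 2) (Seq (Add 23 22 2) (Seq (Add 24 23 2) (Seq (Add 25 24 2)
  (Seq (Add 26 25 2) (Add 27 26 2))))))))).

Definition bfs_start : cmd := (CConst 4 1 ;; CConst 5 1 ;; CPut 2 0 1)%cmd.

Definition search : ram :=
  Seq (compile bfs_start)
  (Seq bfs
  (Seq (compile (CSub 3 2 1))
  (Seq absorb_loop
  (Seq (compile output_start) output_loop)))).

Section Program.

Variables (W n A : nat) (nbrs : nat -> seq nat) (start input : nat -> nat).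
Hypotheses (n_gt0 : 0 < n) (nA : n.+2 <= A) (word_size : A + 7 * n <= W).
Hypothesis nbrs_lt : forall u v, u < n -> v \in nbrs u -> v < n.
Hypothesis start_end : forall u, u < n -> start u + size (nbrs u) <= A.
Hypothesis input_start : forall u, u < n -> input u.+1 = start u.
Hypothesis input_end : forall u, u < n -> input u.+2 = start u + size (nbrs u).
Hypothesis input_nbrs : forall u j, u < n -> j < size (nbrs u) ->
  input (start u + j) = nth 0 (nbrs u) j.
Hypothesis nbrs_connected : forall q : seq nat, 0 \in q ->
  (forall u, u \in q -> {subset nbrs u <= q}) -> forall v, v < n -> v \in q.

Definition initial_regs : nat -> nat := [eta [eta (fun=> 0) with 1 |-> 1] with 2 |-> n].

Definition initial_arrays (k i : nat) : nat := if k is 0 then input i else 0.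

Lemma setup_exec (s : state) : (forall x, regs s x = 0) ->
  memory s =1 input -> input 0 = n -> input n.+1 = A ->
  (forall i, A <= i -> input i = 0) ->
  exists s', exec W setup s 10 s' /\
    represents n A s' initial_regs initial_arrays.
Proof.
move=> s0 sM i0 iA iZ; eexists; split.
  rewrite -[10]/(1 + (1 + (1 + (1 + (1 + (1 + (1 + (1 + (1 + 1))))))))).
  do 9 (apply: exec_Seq;
    first by constructor; rewrite /= ?s0 ?sM ?i0 ?addn1 ?iA; lia).
  by constructor; rewrite /= ?s0 ?sM ?i0 ?addn1 ?iA; lia.
split=> [|| k i k8] /=.
- by do 19 (case; first by rewrite /= ?s0 ?sM ?i0).
- by do 8 (case; first by rewrite /= ?s0 ?sM ?i0 ?addn1 ?iA; lia).
- case: k k8 => [|k] k8 /=; rewrite sM // => _.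
  by rewrite iZ // -addnA leq_addr.
Qed.

Lemma search_runs : runs W n A search
  (15 * (\sum_(v < n) (size (nbrs v)).+1) + 200 * n) initial_regs initial_arrays
  (fun _ a => exists q par s, [/\
     [/\ uniq q, forall v, (v \in q) = (v < n)
       & forall i, 0 < i < n -> par i < i /\ nth 0 q i \in nbrs (nth 0 q (par i))],
     [/\ uniq (0 :: s), forall x, (x \in 0 :: s) = (x < n),
       path (near n par) 0 s & s != [::] -> near n par (last 0 s) 0]
   & forall j, j < n -> a 0 j = nth 0 q (nth 0 (0 :: s) j)]).
Proof.
set D := \sum_(v < n) _.
have n_A : n <= A by lia.
have cA : cost absorb <= 60 by vm_compute.
have cO : cost output_step <= 20 by vm_compute.
have cS : cost output_start <= 30 by vm_compute.
apply: (@runs_weaken _ _ _ _ (cost bfs_start + ((15 * D).+1 + (1 +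
  (((cost absorb).+1 * n.-1).+1 + (cost output_start +
   ((cost output_step).+1 * n).+1)))))).
(* The loops of absorption and output take at most [61 * n] and [21 * n] steps up to constants; the
   rest of [200 * n] covers these constants, as [n] is positive. *)
- have -> : cost bfs_start = 4 by vm_compute.
  have : (cost absorb).+1 * n.-1 <= 61 * n by rewrite leq_mul // leq_pred.
  have : (cost output_step).+1 * n <= 21 * n by rewrite leq_mul.
  by lia.
- by move=> r' a' q; exact: q.
apply: (runs_seq (Q' := fun r a => [/\ bfs_tree n A nbrs input [:: 0] a,
   bfs_registers n 0 [:: 0] r & r 5 = 1])).
  apply: (@runs_wp _ _ _ word_size bfs_start) => //=.
  do 2 (split; first by lia).
  split; first exact: n_gt0.
  split=> //; split=> //=.
  - by move=> v; rewrite inE => /eqP ->.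
  - by move=> i _; rewrite /put /=; case: i => [|[]].
  - by move=> v vn; rewrite /put /= inE; case: eqP.
  - by case=> [|[]].
  - by move=> k i; rewrite /put; case: k => [|[|[|k]]].
move=> r1 a1 [tree1 reg1 r15].
apply: runs_seq.
  exact: (bfs_runs n_gt0 nA word_size nbrs_lt start_end input_start input_end
            input_nbrs tree1 reg1 r15).
move=> r2 a2 [q [tree2 r20 r21 r22 closed_q]].
have [q_gt0 q0] := bfs_root tree2.
have qE v : (v \in q) = (v < n).
  apply/idP/idP; first exact: (bfs_lt tree2).
  apply: nbrs_connected => [|u uq]; first by rewrite -q0 mem_nth.
  by rewrite -(nth_index 0 uq); apply: closed_q; rewrite index_mem.
have size_q := size_segment (bfs_uniq tree2) qE.
have par_lt i : 0 < i < n -> a2 3 i < i.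
  by rewrite -size_q => /(bfs_parent tree2)[].
apply: (runs_seq (Q' := absorb_state n (a2 3) a2 n.-1)).
  apply: (@runs_wp _ _ _ word_size (CSub 3 2 1)) => //=.
  exists (fun=> [::]); split=> //=; first by rewrite r22 r21 subn1; split.
    by rewrite prednK.
  by rewrite prednK //; apply: forest_init => v; rewrite (bfs_blank tree2).
move=> r3 a3 st3; apply: runs_seq.
  exact: (absorb_loop_runs word_size par_lt (fun _ _ => erefl) st3).
move=> r4 a4 st4; apply: runs_seq.
  exact: (output_start_runs n_gt0 n_A word_size st4).
move=> r5 a5 [s [st5 us smem ps ls]].
apply: runs_weaken (leqnn _) _ (output_loop_runs n_gt0 n_A word_size us smem st5).
move=> r6 a6 out; exists q, (a2 3), s; split=> //.
- split=> //; first exact: (bfs_uniq tree2).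
  by move=> i; rewrite -size_q => /(bfs_parent tree2).
- move=> j jn; rewrite out // (bfs_queue tree2) //.
  by rewrite -smem mem_nth // (size_segment us smem).
Qed.

End Program.

(** * The encoded input and its size *)

Section AdjacencyLists.

Variables (n : nat) (e : rel 'I_n) (adj : 'I_n -> seq 'I_n).
Hypothesis adj_e : adjacency_lists e adj.

Definition lists : seq (seq nat) := [seq [seq val w | w <- adj v] | v <- enum 'I_n].

Definition nbrs_of (u : nat) : seq nat := nth [::] lists u.

Definition list_start (u : nat) : nat := n.+2 + sumn (take u (shape lists)).

Lemma size_lists : size lists = n.
Proof. by rewrite size_map size_enum_ord. Qed.

Lemma size_shape_lists : size (shape lists) = n.
Proof. exact: etrans (size_map _ _) size_lists. Qed.

Lemma nbrs_of_ord (v : 'I_n) : nbrs_of v = [seq val w | w <- adj v].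
Proof. by rewrite /nbrs_of (nth_map v) ?size_enum_ord // nth_ord_enum. Qed.

Lemma nbrs_ofP (u v : 'I_n) : (val v \in nbrs_of u) = e u v.
Proof.
rewrite nbrs_of_ord mem_map; last exact: val_inj.
by case: (adj_e u) => _ ->.
Qed.

Lemma nbrs_of_lt u v : u < n -> v \in nbrs_of u -> v < n.
Proof.
move=> un; rewrite (nbrs_of_ord (Ordinal un)) => /mapP[w _ ->].
exact: ltn_ord.
Qed.

Lemma list_startS u : u < n -> list_start u.+1 = list_start u + size (nbrs_of u).
Proof.
move=> un; rewrite /list_start (take_nth 0) ?size_shape_lists //.
by rewrite sumn_rcons nth_shape addnA.
Qed.

Lemma list_end u : u < n -> list_start u + size (nbrs_of u) <= list_start n.
Proof.
move=> un; rewrite -list_startS // leq_add2l -[X in _ <= sumn X](cat_take_drop u.+1).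
by rewrite sumn_cat take_takel // leq_addr.
Qed.

Lemma list_start_n : list_start n = n.+2 + \sum_(v < n) size (nbrs_of v).
Proof.
rewrite /list_start take_oversize ?size_shape_lists // sumnE big_map.
rewrite (big_nth [::]) size_lists big_mkord.
by [].
Qed.

Lemma encode_head : nth 0 (encode_graph adj) 0 = n.
Proof. by []. Qed.

Lemma behead_encode :
  behead (encode_graph adj) = map list_start (iota 0 n.+1) ++ flatten lists.
Proof. by []. Qed.

Lemma encode_start u : u <= n -> nth 0 (encode_graph adj) u.+1 = list_start u.
Proof.
move=> un; rewrite -nth_behead behead_encode nth_cat size_map size_iota ltnS un.
by rewrite (nth_map 0) ?size_iota ?ltnS // nth_iota.
Qed.

Lemma encode_nbrs u j : u < n -> j < size (nbrs_of u) ->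
  nth 0 (encode_graph adj) (list_start u + j) = nth 0 (nbrs_of u) j.
Proof.
rewrite /nbrs_of -nth_shape => un ju.
rewrite /list_start -addnA addSn -nth_behead behead_encode nth_cat size_map size_iota.
rewrite ltnNge leq_addr /= addKn nth_flatten.
by rewrite -/(flatten_index (shape lists) u j) flatten_indexKl // flatten_indexKr.
Qed.

Lemma size_encode : size (encode_graph adj) = list_start n.
Proof.
rewrite -[LHS]/(size (behead (encode_graph adj))).+1 behead_encode.
rewrite size_cat size_map size_iota size_flatten.
by rewrite /list_start take_oversize // size_shape_lists.
Qed.

(** The degrees count the ordered adjacent pairs; at most two of these, [(x, y)] and [(y, x)], have
    the same underlying edge. *)
Lemma degree_sum_edges : \sum_(v < n) size (nbrs_of v) <= 2 * #|edge_set e|.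
Proof.
under eq_bigr => v _.
  rewrite nbrs_of_ord size_map.
  have [uv vE] := adj_e v.
  have -> : size (adj v) = \sum_(w | e v w) 1.
    by rewrite sum1_card -(card_uniqP uv); apply: eq_card => w; rewrite vE.
  over.
rewrite pair_big_dep /=.
rewrite (partition_big (fun p => [set p.1; p.2]) (mem (edge_set e))) /=; last first.
  by move=> [x y] /= xy; apply/imset2P; exists x y; rewrite ?inE.
rewrite mulnC -sum_nat_const; apply: leq_sum => E /imset2P[x y _ _ ->].
rewrite sum1_card; apply: leq_trans (_ : #|[set (x, y); (y, x)]| <= 2); last first.
  by rewrite cards2; case: (_ != _).
apply/subset_leq_card/subsetP => -[z t]; rewrite !inE => /andP[_ /eqP] /= E'.
have: x \in [set z; t] by rewrite E' !inE eqxx.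
have: y \in [set z; t] by rewrite E' !inE eqxx orbT.
have: z \in [set x; y] by rewrite -E' !inE eqxx.
have: t \in [set x; y] by rewrite -E' !inE eqxx orbT.
rewrite !inE !xpair_eqE (eq_sym x) (eq_sym x) (eq_sym y) (eq_sym y).
by case: (z == x); case: (z == y); case: (t == x); case: (t == y).
Qed.

Lemma nbrs_of_connected (q : seq nat) : connected_graph e -> 0 \in q ->
  (forall u, u \in q -> {subset nbrs_of u <= q}) -> forall v, v < n -> v \in q.
Proof.
move=> conn q0 qc v vn.
have n0 : 0 < n by apply: leq_ltn_trans vn.
have /connectP[p] := conn (Ordinal n0) (Ordinal vn).
have : val (Ordinal n0) \in q by [].
rewrite -[v \in q]/(val (Ordinal vn) \in q).
move: (Ordinal vn) (Ordinal n0) => y; elim: p => [|z p IH] x xq /=.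
  by move=> _ ->.
by case/andP=> xz; apply: IH; apply: (qc _ xq); rewrite nbrs_ofP.
Qed.

End AdjacencyLists.

(** * From steps in the tree to walks in the graph *)

Section Cycle.

Variables (n : nat) (e : rel 'I_n) (f : nat -> 'I_n) (par : nat -> nat).
Hypotheses (e_sym : symmetric e) (par_lt : forall i, 0 < i < n -> par i < i).
Hypothesis par_edge : forall i, 0 < i < n -> e (f i) (f (par i)).

Lemma near_walk x y : near n par x y ->
  walk_joined e [in [:: 1; 2; 4]] (f x) (f y).
Proof.
have pe i : 0 < i < n -> e (f (par i)) (f i) by rewrite e_sym => /par_edge.
have par_n i : 0 < i < n -> par i < n.
  by move=> /[dup] /par_lt + /andP[_]; apply: ltn_trans.
case/or4P=> [/andP[yn /eqP <-]|/andP[xn /eqP <-]|/and3P[yn p0 /eqP <-]|].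
- by exists [:: f y]; rewrite /= pe.
- by exists [:: f (par x)]; rewrite /= par_edge.
- have pn : 0 < par y < n by rewrite p0 par_n.
  by exists [:: f (par y); f y]; rewrite /= !pe.
case/or3P=> [/and3P[xn p0 /eqP <-]|/andP[]|/andP[]].
- have pn : 0 < par x < n by rewrite p0 par_n.
  by exists [:: f (par x); f (par (par x))]; rewrite /= !par_edge.
- move=> /andP[xn _] /andP[yn /eqP pxy].
  by exists [:: f (par x); f y]; rewrite /= par_edge // -pxy pe.
- move=> /and3P[xn px0 _] /and3P[yn py0 /eqP pxy].
  have pxn : 0 < par x < n by rewrite px0 par_n.
  have pyn : 0 < par y < n by rewrite py0 par_n.
  (* The walk goes up to the common grandparent and down again. If the parents coincide it repeats a
     vertex, as walks may. *)
  exists [:: f (par x); f (par (par x)); f (par y); f y].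
  by rewrite /= !par_edge // -pxy !pe.
Qed.

Lemma near_cycle s : {in gtn n &, injective f} ->
  (forall x, exists2 i, i < n & x = f i) -> uniq (0 :: s) ->
  (forall x, (x \in 0 :: s) = (x < n)) -> path (near n par) 0 s ->
  (s != [::] -> near n par (last 0 s) 0) ->
  S_hamiltonian_cycle e [in [:: 1; 2; 4]] [seq f i | i <- 0 :: s].
Proof.
move=> f_inj f_onto us smem ps ls; split.
- by rewrite map_inj_in_uniq // => x y; rewrite !smem; apply: f_inj.
- by move=> x; have [i i_n ->] := f_onto x; rewrite map_f // smem.
- move=> x0 i; rewrite size_map => i_s.
  rewrite !(nth_map 0) //; last exact: ltnW.
  by apply: near_walk; apply: (pathP 0 ps).
- move=> x0; rewrite size_map => s1.
  rewrite !(nth_map 0) // nth_last.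
  by apply: near_walk; apply: ls; case: (s) s1.
Qed.

End Cycle.

Definition main : ram := Seq setup search.

Lemma linear_time_cycle : linear_time_S_hamiltonian_cycle [in [:: 1; 2; 4]].
Proof.
(* With [m] edges and [0 < n], memory [A + 7 * n] is at most [8 * n + 2 + 2 * m], and time at most
   [10 + 15 * (n + 2 * m) + 200 * n]. *)
exists main, 10, 250 => n e adj [n0 e_sym e_irr] conn adj_e.
have {}n0 : 0 < n by rewrite card_ord in n0.
set m := #|edge_set e|; set W := 10 * _.
pose A := list_start adj n.
pose nbrs := nbrs_of adj.
have DE := degree_sum_edges adj_e; rewrite -/m -/nbrs in DE.
have AE : A = n.+2 + \sum_(v < n) size (nbrs v) := list_start_n adj.
have sumS : \sum_(v < n) (size (nbrs v)).+1 = n + \sum_(v < n) size (nbrs v).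
  under eq_bigr => v _ do rewrite -add1n.
  by rewrite big_split sum1_card card_ord.
have word_size : A + 7 * n <= W by lia.
have nA : n.+2 <= A by lia.
pose input := nth 0 (encode_graph adj).
have input_start u : u < n -> input u.+1 = list_start adj u.
  by move=> /ltnW; apply: encode_start.
have input_end u : u < n -> input u.+2 = list_start adj u + size (nbrs u).
  by move=> un; rewrite -list_startS //; apply: encode_start.
have input_A : input n.+1 = A by apply: encode_start.
have input_out i : A <= i -> input i = 0.
  by move=> Ai; rewrite /input nth_default // size_encode.
have conn' (q : seq nat) : 0 \in q -> (forall u, u \in q -> {subset nbrs u <= q}) ->
    forall v, v < n -> v \in q.
  by move=> q0 qc v; exact: (nbrs_of_connected adj_e conn q0 qc).
have [s1 [ex1 rep1]] := setup_exec n0 nA word_size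
  (s := initial_state (encode_graph adj)) (fun=> erefl) (fun=> erefl)
  (encode_head adj) input_A input_out.
have [t [s2 [r [a [ex2 t2 rep2 [q [par [s [tree cyc out]]]]]]]]] :=
  search_runs n0 nA word_size (@nbrs_of_lt _ adj) (@list_end _ adj)
    input_start input_end (@encode_nbrs _ adj) conn' rep1.
have [uq qE par_q] := tree; have [us smem ps ls] := cyc.
have size_q := size_segment uq qE; have size_s := size_segment us smem.
(* [f] sends queue positions to vertices; the default is met only for [i >= n]. *)
pose f i := insubd (Ordinal n0) (nth 0 q i).
have q_lt i : i < n -> nth 0 q i < n by move=> i_n; rewrite -qE mem_nth ?size_q.
have fE i : i < n -> val (f i) = nth 0 q i by move=> /q_lt qi; rewrite val_insubd qi.
exists (10 + t), s2, [seq f i | i <- 0 :: s]; split.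
- exact: exec_Seq ex1 ex2.
- by rewrite sumS in t2; lia.
- apply: (@eq_from_nth _ 0) => [|i]; first by rewrite !size_map size_iota -size_s.
  rewrite size_map size_iota => i_n.
  rewrite (nth_map 0) ?size_iota // nth_iota // add0n.
  have [_ _ memE] := rep2.
  have -> : memory s2 i = a 0 i by apply: (memE 0) => //=; lia.
  rewrite -map_comp (nth_map 0) ?size_s // out //.
  by rewrite [RHS]fE // -smem mem_nth ?size_s.
- apply: (near_cycle (par := par)) => //.
  + by move=> i /par_q[].
  + move=> i i_n; have [pi qi] := par_q i i_n.
    have i_n' : i < n by case/andP: i_n.
    by rewrite e_sym -(nbrs_ofP adj_e) -[nbrs_of _ _]/(nbrs _) !fE // (ltn_trans pi).
  + move=> i j i_n j_n /(congr1 val); rewrite !fE // => /eqP.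
    by rewrite nth_uniq ?size_q // => /eqP.
  + move=> x; have xq : val x \in q by rewrite qE ltn_ord.
    have ix : index (val x) q < n by move: xq; rewrite -index_mem size_q.
    by exists (index (val x) q) => //; apply: val_inj; rewrite fE // nth_index.
Qed.

(** * Transport to arbitrary vertex types *)

Lemma cycle_transport (T : finType) (e : rel T) (S : {pred nat}) s :
  S_hamiltonian_cycle (relpre (@enum_val T T) e) S s ->
  S_hamiltonian_cycle e S (map enum_val s).
Proof.
have walk i j : walk_joined (relpre (@enum_val T T) e) S i j ->
    walk_joined e S (enum_val i) (enum_val j).
  by case=> p [ep <- pS]; exists (map enum_val p); rewrite path_map last_map size_map.
case=> us s_all s_step s_close; split.
- by rewrite map_inj_uniq //; apply: enum_val_inj.
- by move=> x; rewrite -(enum_rankK x) map_f.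
- move=> x0 i; rewrite size_map => i_s.
  rewrite !(nth_map (enum_rank x0)) //; last exact: ltnW.
  exact/walk/s_step.
- move=> x0; rewrite size_map => s1.
  rewrite !(nth_map (enum_rank x0)) //; try by case: (s) s1.
  exact/walk/s_close.
Qed.

Theorem theorem9 :
  (forall (T : finType) (e : rel T),
     is_graph e -> connected_graph e ->
     exists s : seq T, S_hamiltonian_cycle e [in [:: 1; 2; 4]] s)
  /\ linear_time_S_hamiltonian_cycle [in [:: 1; 2; 4]].
Proof.
split; last exact: linear_time_cycle.
move=> T e [T0 e_sym e_irr] conn.
(* Existence follows by running the program on a copy of the graph over ['I_#|T|]. *)
have [p [b [c lin]]] := linear_time_cycle.
pose e' : rel 'I_#|T| := relpre (@enum_val T T) e.
have [] := lin _ e' (fun v => enum (e' v)).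
- by split; [rewrite card_ord | move=> x y; apply: e_sym | move=> x; apply: e_irr].
- move=> x y; have /connectP[q eq yq] := conn (enum_val x) (enum_val y).
  have qE : q = map enum_val (map enum_rank q).
    by rewrite -map_comp map_id_in // => z _; apply: enum_rankK.
  apply/connectP; exists (map enum_rank q); first by rewrite -path_map -qE.
  by apply: enum_val_inj; rewrite yq {1}qE last_map.
- by move=> v; split; [exact: enum_uniq | move=> w; rewrite mem_enum].
by move=> t [s [cyc [_ _ _ /cycle_transport cyc']]]; exists (map enum_val cyc).
Qed.
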